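(* Let $d>1$ be an integer and let $\mathfrak{V}_{\leq d}^{\Leftrightarrow}$ be the set of bi-infinite binary strings of VC dimension at most $d$. Then the shift space $\mathfrak{V}_{\leq d}^{\Leftrightarrow}$ is not sofic.
   Context: For a finite binary string $s$ (indexed from $0$), let $n(s)=\{i: s_i=1\}\subseteq\mathbb{N}$. For a (finite, infinite, or bi-infinite) binary string $S$, let $\mathfrak{S}=\{n(s): s \text{ a finite contiguous substring of } S\}$. A set $B\subseteq\mathbb{N}$ is shattered if $\{c\cap B: c\in\mathfrak{S}\}$ is the power set of $B$; the VC dimension of $S$ is the largest size of a shattered set ($\infty$ if none is largest). $\mathfrak{V}_{\leq d}^{\Leftrightarrow}\subseteq\{0,1\}^{\mathbb{Z}}$ is closed and shift-invariant, hence a shift space. A shift space $X\subseteq\{0,1\}^{\mathbb{Z}}$ is sofic iff it has only finitely many distinct follower sets, where, with $B(X)$ the set of finite words occurring in elements of $X$, the follower set of $w\in B(X)$ is $F_X(w)=\{z\in B(X): wz\in B(X)\}$ (equivalently, $X$ is a factor of a shift of finite type). *)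

(* Defs.v *)
From HB Require Import structures.
From mathcomp Require Import all_boot all_order all_algebra.
From mathcomp Require Import boolp classical_sets functions cardinality filter.
From mathcomp Require Import topology.

Set Implicit Arguments.
Unset Strict Implicit.
Unset Printing Implicit Defensive.
Import GRing.Theory.
Local Open Scope classical_set_scope.
Local Open Scope card_scope.
Local Open Scope ring_scope.

(* {0,1}^Z with the product topology of the discrete topology on bool. *)
Definition bistring : Type := prod_topology (fun _ : int => bool).
HB.instance Definition _ := Topological.on bistring.

(* The contiguous substring of length n starting at position a; n = 0 gives
   the empty word. *)
Definition substring (S : bistring) (a : int) (n : nat) : seq bool :=
  mkseq (fun i => S (a + i%:Z)) n.

Definition substrings (S : bistring) : set (seq bool) :=
  [set s | exists a n, s = substring S a n].

(* n(s) = {i | s_i = 1}; positions beyond the end of s are not in n(s). *)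
Definition ones (s : seq bool) : set nat := [set i | nth false s i].

Definition concepts (S : bistring) : set (set nat) := ones @` substrings S.

Definition shattered (C : set (set nat)) (B : set nat) : Prop :=
  [set c `&` B | c in C] = [set A | A `<=` B].

(* The VC dimension of S is the natural number k. It is infinite when this
   holds for no k. *)
Definition VC_dim_is (S : bistring) (k : nat) : Prop :=
  (exists2 B, shattered (concepts S) B & B #= `I_k) /\
  (forall B, shattered (concepts S) B -> B #<= `I_k).

Definition VC_le (d : nat) : set bistring :=
  [set S | exists2 k, (k <= d)%N & VC_dim_is S k].

Definition shift (S : bistring) : bistring := fun i => S (i + 1).

Definition is_shift_space (X : set bistring) : Prop :=
  closed X /\ shift @` X = X.

Definition language (X : set bistring) : set (seq bool) :=
  [set w | exists2 S, X S & substrings S w].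

Definition follower (X : set bistring) (w : seq bool) : set (seq bool) :=
  [set z | language X z /\ language X (w ++ z)].

Definition sofic (X : set bistring) : Prop :=
  finite_set [set follower X w | w in language X].

Lemma shattered0 S : shattered (concepts S) set0.
Proof.
apply/seteqP; split => A /=.
  by case=> c _ <- x [].
move=> A0; exists (ones [::]).
  by exists [::] => //; exists 0, 0%N.
by rewrite setI0; apply/esym; rewrite -subset0.
Qed.

Lemma shattered_finite S B : shattered (concepts S) B -> finite_set B.
Proof.
move=> /seteqP[_ /(_ B)] /= /(_ (fun _ h => h)) [_ [s _ <-] <-].
apply: (@sub_finite_set _ _ `I_(size s)); last exact: finite_II.
by move=> i [si _] /=; rewrite ltnNge; apply: contraTN isT => h;
  move: si; rewrite /ones /= nth_default.
Qed.

Lemma shatteredP S B : shattered (concepts S) B <->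
  forall A, A `<=` B -> exists a n, ones (substring S a n) `&` B = A.
Proof.
split=> [/seteqP[_ h] A /h [_ [_ [a [n ->]] <-] <-]|h]; first by exists a, n.
apply/seteqP; split => A /=; first by move=> [c _ <-] x [].
move=> /h[a [n <-]]; exists (ones (substring S a n)) => //.
by exists (substring S a n) => //; exists a, n.
Qed.

Lemma VC_leP d S :
  VC_le d S <-> forall B, shattered (concepts S) B -> B #<= `I_d.
Proof.
split=> [[k kd [_ h]] B /h Bk|h].
  by apply: card_le_trans Bk _; rewrite card_le_II.
pose P k := `[< exists2 B, shattered (concepts S) B & B #= `I_k >].
have P0 : exists k, P k.
  exists 0%N; apply/asboolP; exists set0; first exact: shattered0.
  by rewrite II0.
have Pd k : P k -> (k <= d)%N.
  move=> /asboolP[B /h Bd Bk]; rewrite -card_le_II.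
  by apply: card_le_trans Bd; move: Bk; rewrite card_eq_le => /andP[].
case: (ex_maxnP P0 Pd) => k /asboolP Pk kmax.
exists k; first by apply: Pd; exact/asboolP.
split=> // B sB; have /finite_setP[m Bm] := shattered_finite sB.
have mk : (m <= k)%N by apply: kmax; apply/asboolP; exists B.
apply: (@card_le_trans _ _ _ `I_m); last by rewrite card_le_II.
by move: Bm; rewrite card_eq_le => /andP[].
Qed.

Lemma substring_shift S a n : substring (shift S) a n = substring S (a + 1) n.
Proof. by apply: eq_map => i; rewrite /shift addrAC. Qed.

Lemma substrings_shift S : substrings (shift S) = substrings S.
Proof.
apply/seteqP; split => s [a [n ->]].
  by exists (a + 1), n; rewrite substring_shift.
by exists (a - 1), n; rewrite substring_shift subrK.
Qed.

Lemma is_shift_space_VC_le d : is_shift_space (VC_le d).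
Proof.
split; last first.
  have VCs S : VC_le d (shift S) = VC_le d S.
    by rewrite /VC_le /VC_dim_is /concepts /= substrings_shift.
  apply/seteqP; split => [_ [S VS <-]|S VS]; first by rewrite VCs.
  pose S' : bistring := fun i => S (i - 1).
  have S'E : shift S' = S by apply/funext => i; rewrite /shift /S' addrK.
  by exists S' => //; rewrite -VCs S'E.
move=> S clS; apply/VC_leP => B sB.
have /finite_setP[m /card_esym/card_set_bijP[f bf]] := shattered_finite sB.
have near_eq i : \forall S' \near S, S' i = S i.
  have := @proj_continuous int (fun=> bool) i S.
  by move=> /(_ _ (discrete_set1 _)).
have near_sh : \forall S' \near S, forall A : {set 'I_m}, exists a n,
    ones (substring S' a n) `&` B = [set f (val i) | i in [set` A]].
  pose P (A : {set 'I_m}) (S' : bistring) := exists a n,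
    ones (substring S' a n) `&` B = [set f (val i) | i in [set` A]].
  apply: (@filter_forall bistring _ P (nbhs S)) => A.
  have AB : [set f (val i) | i in [set` A]] `<=` B.
    by move=> _ [i _ <-]; apply: (set_bij_sub bf); exists (val i) => //=.
  move/shatteredP : sB => /(_ _ AB)[a [n E]].
  have : \forall S' \near S, forall i : 'I_n,
      S' (a + (i : nat)%:Z) = S (a + (i : nat)%:Z).
    apply: (@filter_forall bistring _
      (fun (i : 'I_n) S' => S' (a + (i : nat)%:Z) = S (a + (i : nat)%:Z))
      (nbhs S)).
    by move=> i; exact: near_eq.
  apply: filterS => S' h; exists a, n.
  rewrite -E; congr (ones _ `&` _).
  apply/eq_in_map => i; rewrite mem_iota add0n => /= lin.
  exact: (h (Ordinal lin)).
have [S' [VS' h]] := clS _ near_sh.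
move/VC_leP : VS'; apply; apply/shatteredP => A AB.
have [a [n E]] := h [set i : 'I_m | f (val i) \in A]%SET.
exists a, n; rewrite E; apply/seteqP; split => [_ [i /= + <-]|x Ax].
  by rewrite inE => /set_mem.
have [_ _ /(_ _ (AB _ Ax))[j /= jm fj]] := bf.
by exists (Ordinal jm) => //=; rewrite inE /= fj; exact: mem_set.
Qed.

(* Main.v *)
(** A set [B] is shattered as soon as every subset of [B] containing [max B] is
    cut out, since prefixes of substrings supply the others. Looking back from
    the position of [max B], the VC dimension exceeds [d] iff there are [d]
    offsets such that all [2 ^ d] patterns at these offsets occur before ones;
    this takes at least [2 ^ d] ones. The set of subset sums of the offsets
    [s * 3 ^ i], [i < d], achieves this with exactly [2 ^ d] ones. Let [w_s] be
    the corresponding word stripped of its last [s] letters, [0^(s-1) 1]. Then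
    [0^(s-1) 1] does not follow [w_s], whereas [0^m 1] follows [w_s] for all
    large [m], because a one very far from the others is useless. Hence the
    words [w_s] have infinitely many follower sets. *)

Require Import Defs.
From mathcomp Require Import ssralg ssrint boolp classical_sets.
From mathcomp Require Import cardinality zify.
From mathcomp Require Import all_boot.

Set Implicit Arguments.
Unset Strict Implicit.
Unset Printing Implicit Defensive.

(** * Shattering rephrased as patterns seen backwards from ones *)

Definition detected (S : bistring) d (c : 'I_d -> nat) : Prop :=
  forall A : {set 'I_d}, exists x : int,
    S x /\ forall i, S (x - (c i)%:Z)%R = (i \in A).

Lemma card_set_seq (T : eqType) (s : seq T) :
  uniq s -> ([set` s]%classic #= `I_(size s))%card.
Proof.
elim: s => [_|x s IHs /= /andP[xs us]].
  by rewrite classical_sets.set_nil II0.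
apply/eq_cardSP; exists x; first by rewrite /= mem_head.
suff -> : ([set` x :: s] `\ x = [set` s])%classic by exact: IHs.
apply/seteqP; split=> y /=; rewrite inE.
  by case=> /predU1P[->|//] /(_ erefl).
move=> ys; split; first by rewrite ys orbT.
by move=> yx; move: xs; rewrite -yx ys.
Qed.

Lemma nth_substring S a n i :
  nth false (substring S a n) i = (i < n) && S (a + i%:Z)%R.
Proof.
case: ltnP => ni; first by rewrite nth_mkseq.
by rewrite nth_default // size_mkseq.
Qed.

(** The shattered set consists of [b] and the points [b - c i]; positivity and injectivity of [c]
    make these [d + 1] distinct numbers. *)
Lemma detected_not_VC_le S d (c : 'I_d -> nat) :
  injective c -> (forall i, 0 < c i) -> detected S c -> ~ VC_le d S.
Proof.
move=> cI c0 cS /VC_leP SV; pose b := \max_i c i.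
have cb i : c i <= b by exact: leq_bigmax.
pose s := b :: [seq b - c i | i <- enum 'I_d].
have us : uniq s.
  rewrite /= map_inj_in_uniq ?enum_uniq ?andbT.
    by apply/mapP => -[i _]; have := c0 i; have := cb i; lia.
  by move=> i j _ _ h; apply: cI; move: h; have := cb i; have := cb j; lia.
suff /SV : shattered (concepts S) [set` s]%classic.
  have := card_set_seq us; rewrite /= size_map size_enum_ord => sE.
  by rewrite (card_le_eql sE) card_le_II ltnn.
apply/shatteredP => A As.
have [x [Sx Sxc]] := cS [set i | `[< A (b - c i) >]].
have xb i : (x - b%:Z + (b - c i)%:Z = x - (c i)%:Z)%R.
  by have := cb i; lia.
(* Index [b] of the substring falls on the one at [x]; stopping just before it drops [b] and keeps
   the rest. *)
exists (x - b%:Z)%R, (if `[< A b >] then b.+1 else b).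
apply/seteqP; split => k.
  rewrite /ones /= nth_substring inE => -[/andP[kn Sk] /predU1P[kb|/mapP[i _ ki]]].
    by move: kn; rewrite kb; case: asboolP => //; rewrite ltnn.
  by move: Sk; rewrite ki xb Sxc inE => /asboolP.
move=> Ak; split; last exact: As.
rewrite /ones /= nth_substring; have := As _ Ak.
rewrite /= inE => /predU1P[kb|/mapP[i _ ki]].
  rewrite kb in Ak *; rewrite (asboolT Ak) ltnSn /=.
  by have -> : (x - b%:Z + b%:Z = x)%R by lia.
rewrite ki xb Sxc inE; apply/andP; split; last by apply/asboolP; rewrite -ki.
by have := c0 i; have := cb i; case: ifP => _; lia.
Qed.

(** The offsets are the distances from the largest element of a shattered set to the next [d]
    elements. *)
Lemma not_VC_le_detected S d :
  ~ VC_le d S -> exists2 c : 'I_d -> nat, forall i, 0 < c i & detected S c.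
Proof.
move/VC_leP/existsNP => [B /not_implyP[sB Bd]].
have /finite_seqP[s0 BE] := shattered_finite sB.
pose s := sort geq (undup s0).
have us : uniq s by rewrite sort_uniq undup_uniq.
have Bs : B = [set` s]%classic.
  by rewrite BE; apply/seteqP; split => x /=; rewrite mem_sort mem_undup.
have ds : d < size s.
  rewrite ltnNge; apply/negP => sd; apply: Bd.
  by rewrite Bs (card_le_eql (card_set_seq us)) card_le_II.
have ss : sorted gtn s.
  rewrite gtn_sorted_uniq_geq us; apply: sort_sorted => x y; exact: leq_total.
pose t i := nth 0 s i; pose b := t 0.
have tb (i : 'I_d) : t i.+1 < b.
  have di := ltn_ord i.
  have gtn_trans : transitive gtn by move=> x y z /=; lia.
  by apply: (sorted_ltn_nth gtn_trans 0 ss); rewrite ?inE //; lia.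
have tI (i j : 'I_d) : t i.+1 = t j.+1 -> i = j.
  have ts (k : 'I_d) : k.+1 < size s by apply: leq_ltn_trans ds.
  by move/eqP; rewrite nth_uniq // eqSS => /eqP/val_inj.
have Bt i : i <= d -> B (t i).
  by move=> id; rewrite Bs; apply: mem_nth; apply: leq_ltn_trans ds.
exists (fun i : 'I_d => b - t i.+1) => [i|A]; first by have := tb i; lia.
(* Including [b] forces the substring to extend past [b], so a missing smaller point is a true zero
   of [S], not the default value beyond the end. *)
pose A' := [set k | k = b \/ exists2 i, i \in A & k = t i.+1]%classic.
have [|a [n E]] := (shatteredP S B).1 sB A'.
  by move=> k [->|[i _ ->]]; apply: Bt => //; have := ltn_ord i; lia.
have [kb _] : (ones (substring S a n) `&` B)%classic b by rewrite E; left.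
move: kb; rewrite /ones /= nth_substring => /andP[bn Sb].
exists (a + b%:Z)%R; split=> // i.
have -> : (a + b%:Z - (b - t i.+1)%:Z = a + (t i.+1)%:Z)%R.
  by have := tb i; lia.
have BtS : B (t i.+1) by exact: Bt (ltn_ord i).
apply/idP/idP => [St|iA].
  have : A' (t i.+1).
    rewrite -E; split=> //; rewrite /ones /= nth_substring St andbT.
    by apply: ltn_trans bn; exact: tb.
  by case=> [h|[j jA /tI ->]//]; have := tb i; rewrite h ltnn.
have [] : (ones (substring S a n) `&` B)%classic (t i.+1).
  by rewrite E; right; exists i.
by rewrite /ones /= nth_substring => /andP[].
Qed.

(** * Words padded with zeros, and counting their ones *)

Definition zero_pad (w : seq bool) : bistring :=
  fun x => if x is Posz n then nth false w n else false.

Lemma language_zero_pad (X : set bistring) w : X (zero_pad w) -> language X w.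
Proof.
move=> Xw; exists (zero_pad w) => //; exists 0%R, (size w).
apply: (@eq_from_nth _ false) => [|i iw]; first by rewrite size_mkseq.
by rewrite nth_substring iw GRing.add0r.
Qed.

(** The pattern seen from [x A] determines [A], whence injectivity. The guard [c i <= x A] accounts
    for the zeros at negative positions, where natural subtraction would truncate to 0. *)
Lemma zero_pad_detected w d (c : 'I_d -> nat) : detected (zero_pad w) c ->
  exists2 x : {set 'I_d} -> nat, injective x & forall A, nth false w (x A) /\
    forall i, (c i <= x A) && nth false w (x A - c i) = (i \in A).
Proof.
move=> cw.
have /choice[x xP] : forall A : {set 'I_d}, exists n, nth false w n /\
    forall i, (c i <= n) && nth false w (n - c i) = (i \in A).
  move=> A; have [[n|n] [wn wc]] := cw A; last by [].
  exists n; split=> // i.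
  rewrite -wc; case: leqP => [cn|nc].
    by rewrite (_ : (n%:Z - _)%R = Posz (n - c i)) //; lia.
  by case E : (n%:Z - _)%R => [k|//] /=; lia.
exists x => // A B AB; apply/setP => i.
by rewrite -(xP A).2 -(xP B).2 AB.
Qed.

Definition one_positions (w : seq bool) : seq nat :=
  [seq i <- iota 0 (size w) | nth false w i].

Lemma mem_one_positions w i : (i \in one_positions w) = nth false w i.
Proof.
rewrite mem_filter mem_iota add0n; case: ltnP; rewrite ?andbT // => wi.
by rewrite nth_default.
Qed.

Lemma size_one_positions w : size (one_positions w) = count id w.
Proof.
by rewrite size_filter -[in RHS](mkseq_nth false w) count_map.
Qed.

Lemma few_ones_VC_le d w : count id w < 2 ^ d -> VC_le d (zero_pad w).
Proof.
rewrite ltnNge => /negP wd; apply: contrapT => /not_VC_le_detected[c _].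
move=> /zero_pad_detected[x xI xP]; apply: wd.
rewrite -size_one_positions -[d]card_ord -cardsT -card_powerset cardE.
rewrite -(size_map x); apply: uniq_leq_size.
  by rewrite map_inj_uniq ?enum_uniq.
by move=> _ /mapP[A _ ->]; rewrite mem_one_positions; case: (xP A).
Qed.

(* If every pattern occurred, each offset would be a difference of two ones
   of [u], so the last one would see only zeros, just like the first one. *)
Lemma isolated_one_VC_le d u m : 1 < d -> count id u < 2 ^ d -> size u <= m ->
  VC_le d (zero_pad (u ++ nseq m false ++ [:: true])).
Proof.
move=> d1 + um; rewrite ltnNge => /negP ud; set w := u ++ _.
apply: contrapT => /not_VC_le_detected[c c0 /zero_pad_detected[x xI xP]].
apply: ud; pose q := size u + m.
have nth_w i : nth false w i = (i == q) || nth false u i.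
  rewrite !nth_cat size_nseq nth_nseq if_same; case: ltnP => iu.
    by rewrite ltn_eqF //; lia.
  rewrite [nth _ u _]nth_default // orbF; case: ltnP => im; first by lia.
  case E : (i - size u - m) => [|k] /=; first by lia.
  by rewrite nth_nil; lia.
have xNq A : x A != q -> nth false u (x A).
  by move=> Aq; have [] := xP A; rewrite nth_w (negbTE Aq).
have nth_u i : nth false u i -> i < size u.
  by case: ltnP => // iu; rewrite nth_default.
(* At most one set is seen from [q]. As [1 < d], [[set i]] and the full set differ, so one of them
   is seen from a one of [u]. *)
have cu i : c i < size u.
  have [A iA Aq] : exists2 A : {set 'I_d}, i \in A & x A != q.
    case: (eqVneq (x [set i]) q) => [iq|]; last by exists [set i]; rewrite ?inE.
    exists [set: 'I_d]; rewrite ?inE // -iq (inj_eq xI).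
    apply/eqP => /setP Ti; suff : d <= 1 by lia.
    rewrite -[d]card_ord -(cards1 i) -cardsT; apply: subset_leq_card.
    by apply/subsetP => j; rewrite Ti.
  have := (xP A).2 i; rewrite iA => /andP[cx _].
  exact: leq_ltn_trans cx (nth_u _ (xNq _ Aq)).
(* Looking back from [q] by less than [size u <= m] ends in the block of zeros, so only the empty
   pattern is seen there. *)
have x_q A : A != set0 -> x A != q.
  case/set0Pn => i iA; apply/eqP => Aq.
  have := (xP A).2 i; rewrite iA Aq nth_w => /andP[_ /orP[|/nth_u]].
    by have := cu i; have := c0 i; lia.
  by have := cu i; lia.
have x_u A : A != set0 -> nth false u (x A) by move/x_q/xNq.
(* The first one of [u] has only zeros before it, so it comes on top of the [2 ^ d - 1] ones of [u]
   that see the nonempty patterns. *)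
pose p := find id u.
have x_p A : A != set0 -> x A != p.
  move=> A0; case/set0Pn: (A0) => i iA; apply/eqP => Ap.
  have := (xP A).2 i; rewrite iA Ap nth_w => /andP[cp /orP[/eqP pq|]].
    have := nth_u _ (x_u _ A0); lia.
  have pc : p - c i < p by have := c0 i; lia.
  by have /= -> := before_find false pc.
have T0 : [set: 'I_d] != set0.
  by apply/set0Pn; exists (Ordinal (ltnW d1)); rewrite inE.
have up : nth false u p.
  apply: (nth_find false (a := id)); apply/(has_nthP false).
  by exists (x [set: 'I_d]); [apply: nth_u|]; exact: x_u.
have <- : size (p :: [seq x A | A <- enum [set~ (set0 : {set 'I_d})]]) = 2 ^ d.
  rewrite /= size_map -cardE cardsC1 -cardsT -powersetT card_powerset.
  by rewrite cardsT card_ord prednK // expn_gt0.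
rewrite -size_one_positions; apply: uniq_leq_size.
  rewrite /= map_inj_uniq ?enum_uniq // andbT; apply/mapP => -[A].
  by rewrite mem_enum !inE => /x_p/eqP pA Ap; apply: pA.
move=> i; rewrite inE mem_one_positions => /predU1P[->//|/mapP[A + ->]].
by rewrite mem_enum !inE; exact: x_u.
Qed.

(** * Subset sums of scaled powers of 3 *)

Definition ternary d (a : 'I_d -> bool) : nat := \sum_(i < d) a i * 3 ^ i.

Lemma ternary_recl d (a : 'I_d.+1 -> bool) :
  ternary a = a ord0 + 3 * ternary (fun i => a (lift ord0 i)).
Proof.
rewrite /ternary big_ord_recl muln1 big_distrr /=; congr (_ + _).
by apply: eq_bigr => i _; rewrite /bump /= add1n expnS mulnCA.
Qed.

(* Adding [3 ^ i] to a number with ternary digits 0 and 1 causes no carry. *)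
Lemma ternary_add_digit d (a b : 'I_d -> bool) (i : 'I_d) :
  ternary a = 3 ^ i + ternary b -> a i.
Proof.
elim: d a b i => [a b []//|d IHd a b i]; rewrite !ternary_recl.
case: (unliftP ord0 i) => [j|] -> /=; last first.
  (* Here [a ord0] and [1 + b ord0] are congruent modulo 3 and both below 3, hence equal. *)
  by case: (a ord0) (b ord0) => [] []; lia.
rewrite /bump /= add1n expnS => ab.
apply: (IHd (fun k => a (lift ord0 k)) (fun k => b (lift ord0 k))).
by move: ab; case: (a ord0) (b ord0) => [] []; lia.
Qed.

Lemma ternary_setD1 d (A : {set 'I_d}) i : i \in A ->
  ternary (mem A) = 3 ^ i + ternary (mem (A :\ i)).
Proof.
move=> iA; rewrite /ternary (bigD1 i) //= [in RHS](bigD1 i) //= iA mul1n.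
rewrite setD11 mul0n add0n; congr (_ + _).
by apply: eq_bigr => j ji; rewrite in_setD1 ji.
Qed.

Section ternary_word.
Variables d s : nat.
Hypothesis s_gt0 : 0 < s.

(* The offset [s * 3 ^ d] leaves room for looking back from every one. *)
Definition ternary_pos (A : {set 'I_d}) : nat :=
  s * (3 ^ d + ternary (mem A)).

Definition ternary_one (p : nat) : bool :=
  [exists A : {set 'I_d}, p == ternary_pos A].

Definition ternary_prefix : seq bool :=
  mkseq ternary_one (ternary_pos [set: 'I_d] - s).+1.

Definition distant_one m : seq bool := nseq m false ++ [:: true].

Lemma ternary_pos_max A : ternary_pos A <= ternary_pos [set: 'I_d].
Proof.
rewrite leq_mul2l leq_add2l leq_sum ?orbT // => i _.
by rewrite leq_mul2r /= in_setT; case: (i \in A); rewrite ?orbT.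
Qed.

Lemma leq_ternary_pos A : s <= ternary_pos A.
Proof. by rewrite leq_pmulr // addn_gt0 expn_gt0. Qed.

(** If [i] is in [A], the position reached is that of [A :\ i]; otherwise a one there would
    contradict the absence of carries. *)
Lemma ternary_one_sub (i : 'I_d) A :
  ternary_one (ternary_pos A - s * 3 ^ i) = (i \in A).
Proof.
have sA : s * 3 ^ i <= ternary_pos A.
  by rewrite leq_mul2l ltnW ?orbT // ltn_addr // ltn_exp2l.
apply/existsP/idP => [[B /eqP AB]|iA].
  apply: (@ternary_add_digit d (mem A) (mem B)).
  have : s * (3 ^ d + ternary (mem A)) =
         s * (3 ^ d + (3 ^ i + ternary (mem B))).
    by move: AB sA; rewrite /ternary_pos; lia.
  by move/eqP; rewrite eqn_pmul2l // eqn_add2l => /eqP.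
exists (A :\ i).
by rewrite /ternary_pos (ternary_setD1 iA) !mulnDr addnCA addKn.
Qed.

(** The one of the full set is among the [s] letters cut off, so only proper subsets contribute. *)
Lemma count_ternary_prefix : count id ternary_prefix < 2 ^ d.
Proof.
have -> : 2 ^ d = #|[set~ [set: 'I_d]]|.+1.
  rewrite cardsC1 -cardsT -powersetT card_powerset.
  by rewrite cardsT card_ord prednK // expn_gt0.
rewrite ltnS cardE -(size_map ternary_pos) -size_one_positions.
apply: uniq_leq_size => [|p]; first by rewrite filter_uniq ?iota_uniq.
rewrite mem_filter mem_iota size_mkseq => /andP[+ /andP[_ pT]].
rewrite nth_mkseq // => /existsP[A /eqP pA].
apply/mapP; exists A => //; rewrite mem_enum !inE.
apply: contraTN pT => /eqP AT; rewrite pA AT.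
by have := leq_ternary_pos [set: 'I_d]; lia.
Qed.

(** All ones sit at multiples of [s], so the last one is preceded by [s - 1] zeros. *)
Lemma ternary_prefix_distant_one :
  ternary_prefix ++ distant_one s.-1 =
  mkseq ternary_one (ternary_pos [set: 'I_d]).+1.
Proof.
have sT := leq_ternary_pos [set: 'I_d].
apply: (@eq_from_nth _ false) => [|p].
  by rewrite !size_cat !size_mkseq size_nseq /=; lia.
rewrite !size_cat size_mkseq size_nseq => pT.
rewrite nth_mkseq; last by move: pT => /=; lia.
rewrite nth_cat size_mkseq; case: ltnP => [ps|sp]; first by rewrite nth_mkseq.
rewrite /distant_one nth_cat size_nseq nth_nseq if_same; case: ltnP => ps.
  apply/esym/existsP => -[A /eqP pA].
  have AT : ternary_pos A < ternary_pos [set: 'I_d] by lia.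
  have TA : ternary_pos [set: 'I_d] < s + ternary_pos A by lia.
  by move: AT TA; rewrite -mulnS !ltn_pmul2l //; lia.
have -> : p = ternary_pos [set: 'I_d] by move: pT => /=; lia.
rewrite (_ : _ - _ = 0); last by lia.
by apply/esym/existsP; exists [set: 'I_d].
Qed.

Lemma not_language_ternary_prefix :
  ~ language (VC_le d) (ternary_prefix ++ distant_one s.-1).
Proof.
rewrite ternary_prefix_distant_one => -[S SV [a [n E]]].
have nE : n = (ternary_pos [set: 'I_d]).+1.
  by have := congr1 size E; rewrite !size_mkseq.
have Sp p : p <= ternary_pos [set: 'I_d] -> S (a + p%:Z)%R = ternary_one p.
  move=> pT; have := congr1 (nth false ^~ p) E.
  by rewrite nth_substring nE ltnS pT nth_mkseq // => ->.
apply: (@detected_not_VC_le S d (fun i => s * 3 ^ i)) SV.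
- move=> i j /eqP; rewrite eqn_pmul2l // eqn_exp2l // => /eqP; exact: val_inj.
- by move=> i; rewrite muln_gt0 s_gt0 expn_gt0.
move=> A; exists (a + (ternary_pos A)%:Z)%R; split=> [|i].
  by rewrite Sp ?ternary_pos_max //; apply/existsP; exists A.
have sA : s * 3 ^ i <= ternary_pos A.
  by rewrite leq_mul2l ltnW ?orbT // ltn_addr // ltn_exp2l.
rewrite -ternary_one_sub -Sp; last by have := ternary_pos_max A; lia.
by congr (S _); lia.
Qed.

End ternary_word.

(** * Separating infinitely many follower sets *)

Lemma follower_ternary_prefix d s : 0 < s ->
  ~ follower (VC_le d) (ternary_prefix d s) (distant_one s.-1).
Proof. by move=> s0 [_]; exact: not_language_ternary_prefix. Qed.

Lemma follower_far_distant_one d u m : 1 < d -> count id u < 2 ^ d ->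
  size u <= m -> follower (VC_le d) u (distant_one m).
Proof.
move=> d1 ud um; split; apply: language_zero_pad; last exact: isolated_one_VC_le.
(* The tail itself has a single one, and [1 < 2 ^ d]. *)
apply: few_ones_VC_le; rewrite count_cat count_nseq /=.
by have := ltn_expl d (ltnSn 1); lia.
Qed.

(** Serves to find one distance that suits all of finitely many follower sets. *)
Lemma uniform_bound (T : eqType) (l : seq T) (P : T -> nat -> Prop) :
  (forall x, x \in l -> exists N, forall m, N <= m -> P x m) ->
  exists N, forall x, x \in l -> forall m, N <= m -> P x m.
Proof.
elim: l => [_|y l IHl lP]; first by exists 0.
have [|N NP] := IHl; first by move=> x xl; apply: lP; rewrite inE xl orbT.
have [M MP] := lP y (mem_head y l).
exists (maxn N M) => x; rewrite inE => /predU1P[->|xl] m; rewrite geq_max.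
  by case/andP=> _; exact: MP.
by case/andP=> + _; exact: NP.
Qed.

Theorem theorem6 (d : nat) (hd : 1 < d) : ~ sofic (VC_le d).
Proof.
move=> /finite_seqP[l lE].
have mem_l s : 0 < s -> follower (VC_le d) (ternary_prefix d s) \in l.
  move=> s0.
  have : [set follower (VC_le d) w | w in language (VC_le d)]%classic
    (follower (VC_le d) (ternary_prefix d s)).
    exists (ternary_prefix d s) => //.
    by apply: language_zero_pad; exact/few_ones_VC_le/count_ternary_prefix.
  by rewrite lE.
(* The premise makes [P] vacuous for entries of [l] that are not follower sets of these prefixes. *)
pose P (F : set (seq bool)) m := (exists2 s, 0 < s &
  F = follower (VC_le d) (ternary_prefix d s)) -> F (distant_one m).
have [F _|N NP] := @uniform_bound _ l P.
  have [[s s0 ->]|Fs] := pselect (exists2 s, 0 < s &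
    F = follower (VC_le d) (ternary_prefix d s)); last by exists 0 => m _ /Fs.
  exists (size (ternary_prefix d s)) => m um _.
  exact/follower_far_distant_one/um/count_ternary_prefix.
(* With [s = N.+1] the forbidden tail has exactly [N] zeros, which already meets the common
   bound. *)
apply: (@follower_ternary_prefix d N.+1) => //.
by apply: (NP _ (mem_l N.+1 _)) => //; exists N.+1.
Qed.
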